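(* Let $T>0$, let $\mathbb{U}\subset\mathbb{R}^m$ be compact and non-empty, and let $f:[0,T]\times\mathbb{R}^n\times\mathbb{U}\to\mathbb{R}^n$ be continuous and Lipschitz continuous in $x$ uniformly in $(s,u)$. Let $g\in C(\mathbb{R}^n;\mathbb{R})$ and $\mathcal{X}=\{x\in\mathbb{R}^n\,|\,g(x)\le 0\}$. Let $\underline{v}\in C([0,T]\times\mathbb{R}^n;\mathbb{R})$ be a viscosity subsolution of $-v_t+H(t,x,\nabla v)=0$ on $\Omega=\{(t,x)\in(0,T)\times\mathbb{R}^n\,|\,\underline{v}(t,x)>0\}$, with $\underline{v}(T,x)=\underline{g}(x)$ for all $x\in\mathbb{R}^n$. If $\underline{g}(x)\le 0$ for all $x\in\mathcal{X}$, then for every $t\in[0,T]$, $$\mathcal{G}(t)\subseteq\overline{\mathcal{G}}(t):=\{x\in\mathbb{R}^n\,|\,\underline{v}(t,x)\le 0\}.$$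
   Context: For $t\in[0,T]$, $\mathcal{U}[t,T]$ is the set of measurable maps $u:[t,T]\to\mathbb{U}$. For $x\in\mathbb{R}^n$ and $u\in\mathcal{U}[t,T]$, $\varphi(\cdot;t,x,u)$ denotes the unique (absolutely continuous) solution of $\dot{x}(s)=f(s,x(s),u(s))$ for a.e. $s\in(t,T)$, $x(t)=x$. The backwards reachable set is $\mathcal{G}(t)=\{x\in\mathbb{R}^n\,|\,\exists u\in\mathcal{U}[t,T]\text{ with }\varphi(T;t,x,u)\in\mathcal{X}\}$. The Hamiltonian is $H(t,x,p)=\max_{u\in\mathbb{U}}\langle -p,f(t,x,u)\rangle$. For an open set $\Omega\subseteq(0,T)\times\mathbb{R}^n$, a function $v\in C([0,T]\times\mathbb{R}^n;\mathbb{R})$ is a viscosity supersolution (resp. subsolution) of $-v_t+H(t,x,\nabla v)=0$ on $\Omega$ if for every $\xi\in C^1(\Omega;\mathbb{R})$ such that $v-\xi$ attains a local minimum (resp. local maximum) at $(t_0,x_0)\in\Omega$, one has $-\xi_t(t_0,x_0)+H(t_0,x_0,\nabla\xi(t_0,x_0))\ge 0$ (resp. $\le 0$). *)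

(* Defs.v *)
From HB Require Import structures.
From mathcomp Require Import all_boot all_order all_algebra.
From mathcomp Require Import all_classical all_reals all_analysis.
Set Implicit Arguments. Unset Strict Implicit. Unset Printing Implicit Defensive.
Import Order.TTheory GRing.Theory Num.Theory.
Import numFieldNormedType.Exports.
Local Open Scope classical_set_scope.
Local Open Scope ring_scope.

Section Defs.
Variable R : realType.

Definition Icc (a b : R) : set R := [set s | a <= s <= b].

Definition leb_measurable_set (A : set R) : Prop :=
  exists B N : set R, measurable B /\ measurable N /\
    (lebesgue_measure N = 0)%E /\ ((A `\` B) `|` (B `\` A)) `<=` N.

Definition meas_on {m : nat} (a b : R) (u : R -> 'rV[R]_m) : Prop :=
  forall (i : 'I_m) (c : R),
    leb_measurable_set (Icc a b `&` [set s | u s ord0 i < c]).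

Definition controls {m : nat} (UU : set 'rV[R]_m) (a b : R) : set (R -> 'rV[R]_m) :=
  [set u | meas_on a b u /\ forall s, Icc a b s -> UU (u s)].

Definition abs_cont_on {n : nat} (a b : R) (phi : R -> 'rV[R]_n) : Prop :=
  forall eps : R, 0 < eps -> exists2 delta : R, 0 < delta &
    forall (N : nat) (l r : nat -> R),
      (forall k, (k < N)%N -> a <= l k /\ l k <= r k /\ r k <= b) ->
      (forall k, (k.+1 < N)%N -> r k <= l k.+1) ->
      \sum_(k < N) (r k - l k) < delta ->
      \sum_(k < N) `|phi (r k) - phi (l k)| < eps.

Definition is_solution {n m : nat} (f : R -> 'rV[R]_n -> 'rV[R]_m -> 'rV[R]_n)
    (t T : R) (x : 'rV[R]_n) (u : R -> 'rV[R]_m) (phi : R -> 'rV[R]_n) : Prop :=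
  [/\ abs_cont_on t T phi, phi t = x &
      {ae lebesgue_measure, forall s : R, t < s < T ->
         derivable phi s 1 /\ 'D_1 phi s = f s (phi s) (u s)}].

Definition reach_set {n m : nat} (f : R -> 'rV[R]_n -> 'rV[R]_m -> 'rV[R]_n)
    (UU : set 'rV[R]_m) (g : 'rV[R]_n -> R) (T t : R) : set 'rV[R]_n :=
  [set x | exists2 u, controls UU t T u &
     exists phi, is_solution f t T x u phi /\ g (phi T) <= 0].

Definition hamiltonian {n m : nat} (f : R -> 'rV[R]_n -> 'rV[R]_m -> 'rV[R]_n)
    (UU : set 'rV[R]_m) (t : R) (x p : 'rV[R]_n) : R :=
  sup [set \sum_(i < n) (- p ord0 i) * f t x u ord0 i | u in UU].

Definition dt_ {n : nat} (xi : R -> 'rV[R]_n -> R) (t : R) (x : 'rV[R]_n) : R :=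
  'D_1 (fun s => xi s x) t.
Definition dx_ {n : nat} (xi : R -> 'rV[R]_n -> R) (i : 'I_n) (t : R) (x : 'rV[R]_n) : R :=
  'D_(delta_mx ord0 i) (xi t) x.
Definition grad_ {n : nat} (xi : R -> 'rV[R]_n -> R) (t : R) (x : 'rV[R]_n) : 'rV[R]_n :=
  \row_i dx_ xi i t x.

Definition C1_on {n : nat} (Omega : set (R * 'rV[R]_n)) (xi : R -> 'rV[R]_n -> R) : Prop :=
  forall p, Omega p ->
    [/\ derivable (fun s => xi s p.2) p.1 1,
        (forall i : 'I_n, derivable (xi p.1) p.2 (delta_mx ord0 i)),
        {for p, continuous (fun q : R * 'rV[R]_n => dt_ xi q.1 q.2)} &
        (forall i : 'I_n, {for p, continuous (fun q : R * 'rV[R]_n => dx_ xi i q.1 q.2)})].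

Definition visc_subsolution {n m : nat} (f : R -> 'rV[R]_n -> 'rV[R]_m -> 'rV[R]_n)
    (UU : set 'rV[R]_m) (Omega : set (R * 'rV[R]_n)) (v : R -> 'rV[R]_n -> R) : Prop :=
  forall xi : R -> 'rV[R]_n -> R, C1_on Omega xi ->
  forall t0 x0, Omega (t0, x0) ->
    (\forall q \near (t0, x0), v q.1 q.2 - xi q.1 q.2 <= v t0 x0 - xi t0 x0) ->
    - dt_ xi t0 x0 + hamiltonian f UU t0 x0 (grad_ xi t0 x0) <= 0.

End Defs.

(* Main.v *)
Require Import Defs.
From HB Require Import structures.
From mathcomp Require Import all_boot all_order all_algebra.
From mathcomp Require Import all_classical all_reals all_analysis.
From mathcomp Require Import ring lra.
Import Order.TTheory GRing.Theory Num.Theory.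
Import numFieldNormedType.Exports.
Local Open Scope classical_set_scope.
Local Open Scope ring_scope.

(** Suppose [v t x > 0] although the trajectory [phi] from [x] reaches the target.
    Replace [phi] by its Steklov averages [psi s = 1/d \int_s^(s+d) phi], which are
    C^1, and maximise [v s y - c |y - psi s|^2 + h s], where [h] is increasing and
    bounded by [3/4 v t x].  Since [v] is positive at the start and nonpositive at
    the end of [phi], the maximum is interior and [v > 0] there, so the
    subsolution inequality applies at the maximiser [(s0, x0)]: for
    [p = 2 c (x0 - psi s0)] and every control value [w],
    [p . (phi (s0 + d) - phi s0) / d + h' s0 <= p . f s0 x0 w].
    By the doubling estimate [|p| |x0 - psi s0|] is small, so that
    [p . f s (phi s) (u s)], which is [p . phi' s] almost everywhere, exceeds the
    difference quotient of [p . phi] on all of [[s0, s0 + d]]; this contradicts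
    the mean value inequality for absolutely continuous functions. *)

(** * Uniform continuity on compact sets *)

(** Compactness in its near-covering form, along the filter [0^'+] of radii, merges the local radii
    into one. At a point with local radius [r] for [e / 2], points within [r / 2] and increments
    below [r / 2] remain in the ball of radius [r], and two comparisons with the centre add up to
    [e]. *)
Lemma compact_within_unif_continuous {R : realType} (U : pseudoMetricType R)
    (V : normedModType R) (K : set U) (F : U -> V) (e : R) :
  compact K -> {within K, continuous F} -> 0 < e ->
  exists2 d : R, 0 < d &
    forall x y, K x -> K y -> ball x d y -> `|F x - F y| < e.
Proof.
move=> /compact_near_coveringP cK /subspace_continuousP cF e0.
have := cK _ (0 : R)^'+
  (fun d x => K x -> forall y, K y -> ball x d y -> `|F x - F y| < e) _.
case=> [x Kx|/= d d0 dP]; last first.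
  exists (d / 2); first by rewrite divr_gt0.
  move=> x y Kx Ky xy; apply: (dP (d / 2)) => //=.
    by rewrite sub0r normrN gtr0_norm ?divr_gt0// ltr_pdivrMr// ltr_pMr// ltr1n.
  by rewrite divr_gt0.
have /cvgrPdist_lt /(_ _ (divr_gt0 e0 (ltr0n _ 2))) := cF x Kx.
rewrite near_withinE => /nbhs_ballP[r /= r0 rP].
exists (ball x (r / 2), [set d | d < r / 2]).
  split => /=; first by apply: nbhsx_ballx; rewrite divr_gt0.
  by apply: nbhs_right_lt; rewrite divr_gt0.
move=> [y d]/= [xy dr] Ky z Kz yz.
have yP := rP y (le_ball _ xy) Ky.
have zP : `|F x - F z| < e / 2.
  apply: rP => //; rewrite (splitr r); apply: ball_triangle xy _.
  exact: le_ball (ltW dr) _ yz.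
have {}yP : `|F x - F y| < e / 2.
  by apply: yP; rewrite ler_pdivrMr// ler_pMr// ler1n.
rewrite (_ : F y - F z = (F x - F z) - (F x - F y)).
  by rewrite (le_lt_trans (ler_normB _ _))// (splitr e) ltrD.
by rewrite opprB [RHS]addrC addrA subrK.
Unshelve. all: by end_near. Qed.

(** * Monotonicity of absolutely continuous functions *)

Definition abs_cont_real {R : realType} (a b : R) (psi : R -> R) : Prop :=
  forall eps : R, 0 < eps -> exists2 delta : R, 0 < delta &
    forall (N : nat) (l r : nat -> R),
      (forall k, (k < N)%N -> a <= l k /\ l k <= r k /\ r k <= b) ->
      (forall k, (k.+1 < N)%N -> r k <= l k.+1) ->
      \sum_(k < N) (r k - l k) < delta ->
      \sum_(k < N) `|psi (r k) - psi (l k)| < eps.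

(** A positive derivative at the single point [c] gives no monotonicity near [c]: only pairs that
    straddle [c] are comparable, each through [psi c], by the sign of the difference quotients at
    [c]. *)
Lemma derive_gt0_local {R : realType} (psi : R -> R) (c : R) :
  derivable psi c 1 -> 0 < 'D_1 psi c ->
  exists2 r : R, 0 < r & forall s s', c - r < s -> s <= c -> c <= s' ->
    s' < c + r -> psi s <= psi s'.
Proof.
move=> dpsi; set D := 'D_1 psi c => D0.
have : h^-1 *: (psi (h *: 1 + c) - psi c) @[h --> 0^'] --> D by exact: dpsi.
move=> /cvgrPdist_lt /(_ _ D0) [r /= r0 rP].
have key h : h != 0 -> `|h| < r -> 0 < h^-1 * (psi (h + c) - psi c).
  move=> h0 hr; have := rP h; rewrite /= sub0r normrN => /(_ hr h0).
  rewrite /GRing.scale/= mulr1 ltr_norml => /andP[_]; lra.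
exists r => // s s' rs sc cs' s'r.
apply: (@le_trans _ _ (psi c)).
  have [->//|sc'] := eqVneq s c.
  have := key (s - c); rewrite subr_eq0 => /(_ sc').
  have sc0 : s - c < 0 by rewrite lt_neqAle subr_eq0 sc' subr_le0.
  rewrite ltr0_norm// subrK nmulr_rgt0 ?invr_lt0//; lra.
have [->//|sc'] := eqVneq s' c.
have := key (s' - c); rewrite subr_eq0 => /(_ sc').
have sc0 : 0 < s' - c by rewrite lt_neqAle eq_sym subr_eq0 sc' subr_ge0.
rewrite gtr0_norm// subrK pmulr_rgt0 ?invr_gt0//; lra.
Qed.

(* Cousin's lemma in disguise: the supremum of the points that can be reached
   from [a] by steps along which [psi] does not decrease and by finitely many
   disjoint intervals inside an open set [U] of small measure that contains
   the exceptional set is [b]. *)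
Lemma abs_cont_real_derive_gt0 {R : realType} (a b : R) (psi : R -> R) :
  a <= b -> abs_cont_real a b psi ->
  {ae lebesgue_measure, forall s : R, a < s < b ->
     derivable psi s 1 /\ 0 < 'D_1 psi s} ->
  psi a <= psi b.
Proof.
move=> ab acpsi [N0 [mN0 N00 N0P]]; apply/ler_addgt0Pl => eps eps0.
have [delta delta0 deltaP] := acpsi _ eps0.
(* The derivative is controlled only in the open interval, so the endpoints join the exceptional
   set. *)
pose N1 := N0 `|` ([set a] `|` [set b]).
have mN1 : measurable N1 by do 2 (apply: measurableU => //).
have N10 : lebesgue_measure N1 = 0%E.
  apply/eqP; rewrite eq_le measure_ge0 andbT.
  rewrite (le_trans (measureU2 _ _ _))//; first exact: measurableU.
  rewrite [X in (X + _ <= _)%E]N00 add0e (le_trans (measureU2 _ _ _))//.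
  by rewrite [X in (X + _ <= _)%E]lebesgue_measure_set1
    [X in (_ + X <= _)%E]lebesgue_measure_set1 adde0.
have [U [oU N1U Ud]] : exists U : set R, [/\ open U, N1 `<=` U &
    (lebesgue_measure (U `\` N1) < delta%:E)%E].
  by apply: lebesgue_regularity_outer => //; rewrite [X in (X < _)%E]N10 ltry.
have mU : measurable U by exact: measurable_realfun.open_measurable.
have {}Ud : (lebesgue_measure U < delta%:E)%E.
  apply: le_lt_trans Ud.
  apply: (@le_trans _ _ (lebesgue_measure ((U `\` N1) `|` N1))).
    apply: le_measure; rewrite ?inE//; last by rewrite setDKU.
    by apply: measurableU => //; exact: measurableD.
  apply: le_trans (measureU2 _ _ _) _ => //; first exact: measurableD.
  by rewrite [X in (_ + X <= _)%E]N10 adde0.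
have goodP s : a <= s <= b -> ~ U s ->
    exists2 r : R, 0 < r & forall x y, s - r < x -> x <= s -> s <= y ->
    y < s + r -> psi x <= psi y.
  move=> /andP[as_ sb] nUs.
  have nN1 : ~ N1 s by move=> /N1U.
  have sa : s != a by apply: contra_notN nN1 => /eqP ->; right; left.
  have sb' : s != b by apply: contra_notN nN1 => /eqP ->; right; right.
  suff [dpsi D0] : derivable psi s 1 /\ 0 < 'D_1 psi s.
    exact: derive_gt0_local.
  have : ~ N0 s by move=> ?; apply: nN1; left.
  move=> /(contra_not (@N0P s)) /contrapT; apply.
  by rewrite !lt_neqAle sb' eq_sym sa as_ sb.
(* The drop of [psi] from [a] to [s] is charged to finitely many disjoint intervals. Bounding their
   length by the measure of [U] within [[a, s]], rather than of all of [U], lets the bound survive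
   the addition of a further interval. *)
pose Q s := exists N (l r : nat -> R), [/\
  (forall k, (k < N)%N -> a <= l k /\ l k <= r k /\ r k <= s),
  (forall k, (k.+1 < N)%N -> r k <= l k.+1),
  ((\sum_(k < N) (r k - l k))%:E <= lebesgue_measure (U `&` `[a, s]))%E &
  psi a - psi s <= \sum_(k < N) `|psi (r k) - psi (l k)|].
pose S := [set s | a <= s <= b /\ Q s].
have mUI x y : measurable (U `&` `[x, y]) by apply: measurableI.
suff : Q b.
  move=> [N [l [r [h1 h2 h3 h4]]]].
  have := deltaP N l r h1 h2 _; rewrite -lerBlDr => sume; apply: le_trans h4 _.
  apply/ltW/sume; rewrite -lte_fin; apply: le_lt_trans h3 _.
  by apply: le_lt_trans Ud; apply: le_measure; [exact: (mem_set (mUI _ _))|exact/mem_set|move=> ? []].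
have Sa : S a.
  split; first by rewrite lexx.
  by exists 0%N, (fun=> 0), (fun=> 0); split => //; rewrite !big_ord0// subrr.
have supS : has_sup S.
  by split; [exists a|exists b => s [/andP[]]].
pose c := sup S.
have ac : a <= c by exact: sup_upper_bound.
have cb : c <= b by apply: ge_sup; [exists a|move=> s [/andP[]]].
have step s s' : S s -> s <= s' -> s' <= b -> psi s <= psi s' -> S s'.
  move=> [/andP[as_ sb] [N [l [r [h1 h2 h3 h4]]]]] ss' s'b pss'.
  split; first by rewrite (le_trans as_ ss') s'b.
  exists N, l, r; split => //.
  - by move=> k /h1[? [? ?]]; split => //; split => //; exact: le_trans ss'.
  - apply: le_trans h3 _; apply: le_measure; [exact: (mem_set (mUI _ _))..|].
    by apply: setIS; apply: subset_itvl; rewrite bnd_simp.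
  - by apply: le_trans h4; rewrite lerB.
have jump s s' : S s -> s <= s' -> s' <= b -> `[s, s'] `<=` U -> S s'.
  move=> [/andP[as_ sb] [N [l [r [h1 h2 h3 h4]]]]] ss' s'b ssU.
  split; first by rewrite (le_trans as_ ss') s'b.
  exists N.+1, (fun k => if (k < N)%N then l k else s),
    (fun k => if (k < N)%N then r k else s'); split.
  - move=> k _; case: ifPn => [/h1[? [? ?]]|_]; last by [].
    by split => //; split => //; exact: le_trans ss'.
  - move=> k; rewrite ltnS => kN; rewrite kN; case: ifPn => [|_].
      exact: h2.
    by have [_ []] := h1 _ kN.
  - rewrite big_ord_recr/= ltnn EFinD.
    under eq_bigr do rewrite ltn_ord.
    have -> : U `&` `[a, s'] = (U `&` `[a, s]) `|` `]s, s'].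
      rewrite (@itv_bndbnd_setU _ _ (BLeft a) (BRight s) (BRight s')) ?bnd_simp//.
      rewrite setIUr; congr (_ `|` _); apply/setIidPr.
      by apply: subset_trans ssU; apply: subset_itvr; rewrite bnd_simp.
    rewrite measureU; [|exact: mUI|exact: measurable_itv|].
      apply: leeD => //; rewrite [X in (_ <= X)%E]lebesgue_measure_itv/= lte_fin.
      by case: ltgtP ss' => // <- _; rewrite subrr.
    apply/seteqP; split => // x/= [[_]]; rewrite !in_itv/= => /andP[_ xs].
    by move=> /andP[]; rewrite ltNge xs.
  - rewrite big_ord_recr/= ltnn.
    under eq_bigr do rewrite ltn_ord.
    have := ler_norm (- (psi s' - psi s)); rewrite normrN; move: h4; lra.
(* If membership in [S] passes across [c] up to distance [r], then [c] is in [S], and [c < b] would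
   put a point of [S] beyond its supremum. *)
have extend r : 0 < r ->
    (forall x y, S x -> c - r < x -> x <= c -> c <= y -> y < c + r -> y <= b -> S y) ->
    c = b /\ S c.
  move=> r0 H.
  have [x Sx cx] := sup_adherent r0 supS.
  have xc : x <= c by exact: sup_upper_bound.
  have Sc : S c by apply: (H x) => //; rewrite ltrDl.
  split => //; apply/eqP; rewrite eq_le cb/= leNgt; apply/negP => ltcb.
  pose y := Num.min (c + r / 2) b.
  have cy : c < y by rewrite lt_min ltcb andbT ltrDl divr_gt0.
  have : S y.
    apply: (H c) => //; [by rewrite ltrBlDr ltrDl|exact: ltW| |by rewrite ge_min lexx orbT].
    rewrite gt_min ltrD2l ltr_pdivrMr// ltr_pMr// ltr1n//.
  by move=> /(sup_upper_bound supS); rewrite leNgt cy.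
suff [<- []//] : c = b /\ S c.
have [Uc|nUc] := pselect (U c).
  have [r /= r0 rP] : \forall x \near c, U x by exact: open_nbhs_nbhs.
  apply: (extend r r0) => x y Sx cx xc cy yc yb; apply: (jump x) => //.
    exact: le_trans cy.
  move=> z /=; rewrite in_itv/= => /andP[xz zy]; apply: rP => /=.
  by rewrite ltr_norml; apply/andP; split; lra.
have [r r0 rP] := goodP c (introT andP (conj ac cb)) nUc.
apply: (extend r r0) => x y Sx cx xc cy yc yb; apply: (step x) => //.
  exact: le_trans cy.
exact: rP.
Qed.

(** * Steklov averages of a scalar function *)

(** The average is a difference quotient of an antiderivative [F] of [phi], so its derivative is the
    difference quotient of [phi]; the mean value theorem for [F] shows that it is a value of [phi]
    on [[s, s + d]]. *)
Lemma steklov_average {R : realType} (phi : R -> R) (d : R) :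
  continuous phi -> 0 < d ->
  exists psi : R -> R, forall s : R, 0 <= s ->
    is_derive s 1 psi ((phi (s + d) - phi s) / d) /\
    exists2 r, s <= r <= s + d & psi s = phi r.
Proof.
move=> cphi d0.
(* The base point is negative so that every [s >= 0], including [0], is interior to the interval of
   integration. *)
pose F (x : R) := (\int[lebesgue_measure]_(t in [set` `[(-1 : R), x]]) (phi t))%R.
have dF (s : R) : 0 <= s -> is_derive s 1 F (phi s).
  move=> s0.
  have int1 : lebesgue_measure.-integrable `[-1, s + 1] (EFin \o phi).
    apply: continuous_compact_integrable; first exact: segment_compact.
    exact: continuous_subspaceT.
  have [||dF F'] := @continuous_FTC1_closed R phi (-1) s (s + 1) _ int1 _ (cphi s).
  - by rewrite ltrDl.
  - by lra.
  - by apply: DeriveDef; [exact: dF|rewrite -derive1E].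
exists (fun s => (F (s + d) - F s) / d) => s s0.
have sd0 : 0 <= s + d by rewrite addr_ge0// ltW.
split.
  have h1 := dF _ s0; have h2 := dF _ sd0.
  have h3 : is_derive s 1 (fun s => F (s + d)) (phi (s + d)).
    have hs : is_derive s 1 (fun x : R => x + d) 1 by exact: is_derive_shift.
    have := @is_derive1_comp R F (fun x => x + d) s _ _ h2 hs.
    by rewrite mulr1.
  rewrite (_ : (fun s => _) = (fun x => d^-1 *: (F (x + d) - F x))); last first.
    by apply/funext => x; rewrite mulrC.
  rewrite mulrC.
  apply: is_deriveZ.
have [|||r] := @MVT_segment R F phi s (s + d).
- by rewrite lerDl ltW.
- by move=> x; rewrite in_itv/= => /andP[sx _]; apply: dF; rewrite (le_trans s0)// ltW.
- apply: continuous_in_subspaceT => x; rewrite inE/= in_itv/= => /andP[sx _].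
  apply: differentiable_continuous; apply/derivable1_diffP.
  by have [] := dF x (le_trans s0 sx).
- rewrite in_itv/= => rP; rewrite addrAC subrr add0r => ->.
  by exists r => //; rewrite mulfK// gt_eqF.
Qed.

(** * Inner products and the mean value inequality along curves *)

Definition dotr {R : realType} {n : nat} (p x : 'rV[R]_n) : R :=
  \sum_(i < n) p ord0 i * x ord0 i.

Lemma coord_le_norm {R : realType} {n : nat} (x : 'rV[R]_n) (i : 'I_n) :
  `|x ord0 i| <= `|x|.
Proof.
rewrite [leRHS]/Num.Def.normr/= mx_normrE.
exact: (le_bigmax _ (fun ij : 'I_1 * 'I_n => `|x ij.1 ij.2|) (ord0, i)).
Qed.

Lemma norm_rV_lt {R : realType} {n : nat} (x : 'rV[R]_n) (e : R) : 0 < e ->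
  (forall i, `|x ord0 i| < e) -> `|x| < e.
Proof.
move=> e0 xe; rewrite [ltLHS]/Num.Def.normr/= mx_normrE.
by apply/bigmax_ltP; split => // -[i j] _ /=; rewrite (ord1 i).
Qed.

(** Row vectors carry the sup norm, whence the factor [n] where the Euclidean norm would have
    none. *)
Lemma norm_dotr {R : realType} {n : nat} (p x : 'rV[R]_n) :
  `|dotr p x| <= n%:R * `|p| * `|x|.
Proof.
rewrite (le_trans (ler_norm_sum _ _ _))//.
have -> : n%:R * `|p| * `|x| = \sum_(i < n) `|p| * `|x|.
  by rewrite sumr_const card_ord -mulrA mulr_natl.
by apply: ler_sum => i _; rewrite normrM ler_pM// coord_le_norm.
Qed.

Lemma dotrB {R : realType} {n : nat} (p x y : 'rV[R]_n) :
  dotr p (x - y) = dotr p x - dotr p y.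
Proof. by rewrite -sumrB; apply: eq_bigr => i _; rewrite !mxE mulrBr. Qed.

Lemma is_derive_dotr {R : realType} {n : nat} (p : 'rV[R]_n)
    (phi : R -> 'rV[R]_n) (s : R) : derivable phi s 1 ->
  is_derive s 1 (fun s => dotr p (phi s)) (dotr p ('D_1 phi s)).
Proof.
move=> dphi; rewrite /dotr.
have -> : (fun s => \sum_(i < n) p ord0 i * phi s ord0 i) =
    \sum_(i < n) (p ord0 i *: (fun s => phi s ord0 i)).
  by apply/funext => x; rewrite fct_sumE.
apply: is_derive_sum => i; rewrite derive_mx// mxE.
by apply/is_deriveZ/derivableP; exact: (derivable_mxP _ _ _).1.
Qed.

(** Subtracting [M * s] from [dotr p (phi s)] leaves an absolutely continuous function with positive
    derivative almost everywhere, to which the monotonicity result applies. *)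
Lemma abs_cont_on_increment_ge {R : realType} {n : nat} (a b : R)
    (phi : R -> 'rV[R]_n) (p : 'rV[R]_n) (M : R) :
  a <= b -> abs_cont_on a b phi ->
  {ae lebesgue_measure, forall s : R, a < s < b ->
     derivable phi s 1 /\ M < dotr p ('D_1 phi s)} ->
  M * (b - a) <= dotr p (phi b) - dotr p (phi a).
Proof.
move=> ab acphi dphi.
suff : dotr p (phi a) - M * a <= dotr p (phi b) - M * b by rewrite mulrBr; lra.
apply: (@abs_cont_real_derive_gt0 R a b (fun s => dotr p (phi s) - M * s)) => //.
  move=> e e0.
  (* Lipschitz constants of the two terms, each increased by 1 to allow division; each term receives
     [e / 2]. *)
  pose C := n%:R * `|p| + 1; pose C' := `|M| + 1.
  have C0 : 0 < C by rewrite ltr_wpDl// mulr_ge0.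
  have C'0 : 0 < C' by rewrite ltr_wpDl.
  have [d d0 dP] := acphi _ (divr_gt0 (divr_gt0 e0 (ltr0n _ 2)) C0).
  exists (Num.min d (e / 2 / C')); first by rewrite lt_min d0 !divr_gt0.
  move=> N l r lr rl; rewrite lt_min => /andP[srd sre].
  have H1 := dP N l r lr rl srd.
  apply: (@le_lt_trans _ _ (C * (\sum_(k < N) `|phi (r k) - phi (l k)|) +
      C' * \sum_(k < N) (r k - l k))); last first.
    rewrite (splitr e) ltrD//; first by rewrite mulrC -ltr_pdivlMr.
    by rewrite mulrC -ltr_pdivlMr.
  rewrite !mulr_sumr -big_split/=; apply: ler_sum => k _.
  have [_ [lrk _]] := lr k (ltn_ord k).
  have -> : dotr p (phi (r k)) - M * r k - (dotr p (phi (l k)) - M * l k) =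
    dotr p (phi (r k) - phi (l k)) - M * (r k - l k) by rewrite dotrB; ring.
  rewrite (le_trans (ler_normB _ _))// lerD//.
    by rewrite (le_trans (norm_dotr _ _))// ler_wpM2r// lerDl.
  by rewrite normrM (ger0_norm (_ : 0 <= r k - l k)) ?subr_ge0// ler_wpM2r ?subr_ge0// lerDl.
case: dphi => [N [mN N0 NP]]; exists N; split => //; apply: subset_trans NP.
apply: subsetC => s/= + asb => /(_ asb)[dphi Ms].
have h := is_derive_dotr p _ _ dphi.
have h2 : is_derive s 1 (fun s : R => M * s) M.
  have := @is_deriveZ _ _ _ id M s 1 1 _; rewrite /GRing.scale/= mulr1; apply.
have := @is_deriveB _ _ _ _ _ _ _ _ _ h h2.
move=> [dd ->]; split => //; by rewrite subr_gt0.
Qed.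

(** * The quadratic test function *)

Lemma is_derive_coord {R : realType} {n : nat} (x v : 'rV[R]_n) (j : 'I_n) :
  is_derive x v (fun y : 'rV[R]_n => y ord0 j) (v ord0 j).
Proof.
have did : derivable (id : 'rV[R]_n -> 'rV[R]_n) x v by exact: derivable_id.
apply: DeriveDef; first exact: (derivable_mxP _ _ _).1 did _ _.
have := derive_mx did; rewrite derive_id => /matrixP /(_ ord0 j).
by rewrite mxE => <-.
Qed.

Lemma is_derive_sqr {R : realType} {V : normedModType R} (F : V -> R) (x v : V)
    (dF : R) :
  is_derive x v F dF -> is_derive x v (fun y => F y ^+ 2) (2 * F x * dF).
Proof.
move=> h; have := @is_deriveX R V F 2 x v dF h.
rewrite expr1 /GRing.scale/=.
by rewrite (_ : F ^+ 2 = fun y => F y ^+ 2)//; apply/funext => y; rewrite fctE.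
Qed.

Definition sqdist {R : realType} {n : nat} (x y : 'rV[R]_n) : R :=
  \sum_(i < n) (x ord0 i - y ord0 i) ^+ 2.

(** The time derivative of the penalty is minus the product of its gradient with the velocity of
    [psi]. The subsolution inequality for [xi] therefore compares [dpsi] with the dynamics in the
    direction of the gradient, with [dh] as a gain. *)
Lemma tracking_test_function {R : realType} {n : nat} (c : R)
    (psi dpsi : R -> 'rV[R]_n) (h dh : R -> R) (Omega : set (R * 'rV[R]_n)) :
  (forall i (s : R), 0 <= s ->
     is_derive s 1 (fun s => psi s ord0 i) (dpsi s ord0 i)) ->
  (forall i, continuous (fun s => dpsi s ord0 i)) ->
  (forall s : R, is_derive s 1 h (dh s)) -> continuous dh ->
  (forall p, Omega p -> 0 < p.1) ->
  let xi := fun s x => c * sqdist x (psi s) - h s in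
  [/\ forall s x, 0 <= s -> dt_ xi s x = - dotr (grad_ xi s x) (dpsi s) - dh s,
      forall s x, grad_ xi s x = (c * 2) *: (x - psi s),
      C1_on Omega xi &
      forall p, 0 <= p.1 ->
        {for p, continuous (fun q : R * 'rV[R]_n => xi q.1 q.2)}].
Proof.
move=> dpsiP cdpsi dhP cdh Omega0 xi.
have xit (s : R) x : 0 <= s -> is_derive s 1 (fun s => xi s x)
    (c * (\sum_(i < n) (2 * (x ord0 i - psi s ord0 i) * (- dpsi s ord0 i))) - dh s).
  move=> s0.
  have -> : (fun s => xi s x) =
      (c *: (\sum_(i < n) (fun s => (x ord0 i - psi s ord0 i) ^+ 2)) - h).
    by apply/funext => y; rewrite /xi /sqdist fctE /= fctE fct_sumE.
  apply: is_deriveB; apply: is_deriveZ; apply: is_derive_sum => i.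
  apply: (@is_derive_sqr _ _ (fun s => x ord0 i - psi s ord0 i)).
  have := is_deriveB (is_derive_cst (x ord0 i) s 1) (dpsiP i s s0).
  by rewrite sub0r.
have xix i s x : is_derive x (delta_mx ord0 i) (xi s)
    (c * 2 * (x ord0 i - psi s ord0 i)).
  have -> : xi s = (c *: (\sum_(j < n) (fun x : 'rV[R]_n => (x ord0 j - psi s ord0 j) ^+ 2))
       - cst (h s)).
    by apply/funext => y; rewrite /xi /sqdist fctE /= fctE fct_sumE.
  apply: is_derive_eq.
    apply: is_deriveB; apply: is_deriveZ; apply: is_derive_sum => j.
    apply: (@is_derive_sqr _ _ (fun x : 'rV[R]_n => x ord0 j - psi s ord0 j)).
    exact: is_deriveB (is_derive_coord x (delta_mx ord0 i) j) (is_derive_cst (psi s ord0 j) x _).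
  rewrite subr0 (bigD1 i)//= big1 => [|j ji]; last first.
    by rewrite mxE eqxx (negbTE ji) !subr0 mulr0.
  by rewrite mxE !eqxx subr0 addr0 mulr1 /GRing.scale/= mulrA.
have gradE s x : grad_ xi s x = (c * 2) *: (x - psi s).
  by apply/rowP => i; rewrite !mxE /dx_; have [_ ->] := xix i s x.
have dtE s x : 0 <= s -> dt_ xi s x = - dotr (grad_ xi s x) (dpsi s) - dh s.
  move=> s0; rewrite /dt_; have [_ ->] := xit s x s0; congr (_ - _).
  rewrite gradE mulr_sumr -sumrN; apply: eq_bigr => i _; rewrite !mxE; ring.
have cpsi i (s : R) : 0 <= s -> {for s, continuous (fun s => psi s ord0 i)}.
  move=> s0; apply: differentiable_continuous; apply/derivable1_diffP.
  by have [] := dpsiP i s s0.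
have cdiff i (p : R * 'rV[R]_n) : 0 <= p.1 ->
    {for p, continuous (fun q : R * 'rV[R]_n => q.2 ord0 i - psi q.1 ord0 i)}.
  move=> p0; apply: cvgB.
    apply: (@cvg_comp _ _ _ snd (fun x : 'rV[R]_n => x ord0 i)); first exact: cvg_snd.
    exact: coord_continuous.
  apply: (@cvg_comp _ _ _ fst (fun s => psi s ord0 i)); first exact: cvg_fst.
  exact: cpsi.
split => // p.
  move=> /Omega0 p0; split.
  - by have [] := xit p.1 p.2 (ltW p0).
  - by move=> i; have [] := xix i p.1 p.2.
  (* The formula for [dt_] holds only at nonnegative times; continuity at [p] needs it on a whole
     neighbourhood. *)
  - have pos : \forall q \near p, 0 < q.1.
      have fstp : fst q @[q --> p] --> p.1 by exact: cvg_fst.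
      exact: cvgr_gt fstp _ p0.
    have cg : {for p, continuous (fun q : R * 'rV[R]_n =>
        - (\sum_(i < n) c * 2 * (q.2 ord0 i - psi q.1 ord0 i) * dpsi q.1 ord0 i)
        - dh q.1)}.
      apply: cvgB; last first.
        by apply: (@cvg_comp _ _ _ fst dh); [exact: cvg_fst|exact: cdh].
      apply: cvgN; apply: cvg_big => [|i _]; first exact: add_continuous.
      apply: cvgM; first by apply: cvgM; [exact: cvg_cst|apply: cdiff; exact: ltW].
      by apply: (@cvg_comp _ _ _ fst (fun s => dpsi s ord0 i)); [exact: cvg_fst|exact: cdpsi].
    have dtE' s x : 0 <= s -> dt_ xi s x =
        - (\sum_(i < n) c * 2 * (x ord0 i - psi s ord0 i) * dpsi s ord0 i) - dh s.
      move=> s0; rewrite dtE// gradE; congr (- _ - _).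
      by apply: eq_bigr => i _; rewrite !mxE.
    rewrite /prop_for /continuous_at dtE' ?ltW//.
    apply: cvg_trans cg; apply: near_eq_cvg; near=> q; rewrite dtE'// ltW//.
    by near: q.
  - move=> i.
    have -> : (fun q : R * 'rV[R]_n => dx_ xi i q.1 q.2) =
        (fun q => c * 2 * (q.2 ord0 i - psi q.1 ord0 i)).
      by apply/funext => q; rewrite /dx_; have [_ ->] := xix i q.1 q.2.
    by apply: cvgM; [exact: cvg_cst|apply: cdiff; exact: ltW].
move=> p0; apply: cvgB.
  apply: cvgM; first exact: cvg_cst.
  apply: cvg_big => [|i _]; first exact: add_continuous.
  by under eq_cvg do rewrite expr2; rewrite expr2; apply: cvgM; exact: cdiff.
have ch : {for p.1, continuous h}.
  apply: differentiable_continuous; apply/derivable1_diffP.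
  by have [] := dhP p.1.
by apply: (@cvg_comp _ _ _ fst h); [exact: cvg_fst|exact: ch].
Unshelve. all: by end_near. Qed.

(** * Continuity, compactness, clamped trajectories and the time barrier *)

Lemma within_continuous_precomp {X Y Z : topologicalType} (A : set X) (B : set Y)
    (e : X -> Y) (F : Y -> Z) :
  continuous e -> (forall x, A x -> B (e x)) ->
  {within B, continuous F} -> {within A, continuous (F \o e)}.
Proof.
move=> ce AB /subspace_continuousP cF; apply/subspace_continuousP => x Ax.
move=> W WF.
have H : nbhs (e x) (fun y => B y -> W (F y)) := cF _ (AB _ Ax) W WF.
change (nbhs x (fun y => A y -> W (F (e y)))).
have : nbhs x (fun y => B (e y) -> W (F (e y))) := ce x _ H.
by apply: filterS => y/= By Ay; apply: By; exact: AB.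
Qed.

Lemma compact_closed_ball0 {R : realType} {n : nat} (B : R) :
  compact [set x : 'rV[R]_n | `|x| <= B].
Proof.
apply: bounded_closed_compact.
  exists B; split; first exact: num_real.
  by move=> M BM x/= xB; rewrite (le_trans xB)// ltW.
rewrite (_ : [set x | _] = closed_ball_ Num.norm 0 B).
  exact: closed_closed_ball_.
by apply/seteqP; split => x/=; rewrite /closed_ball_/= sub0r normrN.
Qed.

(** A trajectory is constrained only on its own time interval; composed with this projection it
    becomes continuous on the whole line, as averaging requires. *)
Definition clamp {R : realType} (a b s : R) : R := Num.max a (Num.min b s).

(** This is absolute continuity for a single interval, since [clamp] is nondecreasing and
    1-Lipschitz in time. *)
Lemma abs_cont_on_clamp {R : realType} {n : nat} (a b : R) (phi : R -> 'rV[R]_n)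
    (e : R) : a <= b -> abs_cont_on a b phi -> 0 < e ->
  exists2 d, 0 < d & forall s s', `|s - s'| < d ->
    `|phi (clamp a b s) - phi (clamp a b s')| < e.
Proof.
move=> ab acphi e0; have [d d0 dP] := acphi _ e0; exists d => //.
have H s s' : s <= s' -> s' - s < d ->
    `|phi (clamp a b s') - phi (clamp a b s)| < e.
  move=> ss' s'sd.
  have := dP 1%N (fun=> clamp a b s) (fun=> clamp a b s').
  rewrite !big_ord1; apply => //.
    move=> _ _; rewrite /clamp /Num.max /Num.min.
    by repeat case: ifPn => //; rewrite ?ltNge ?negbK ?lexx; lra.
  apply: le_lt_trans s'sd; rewrite /clamp /Num.max /Num.min.
  by repeat case: ifPn; lra.
move=> s s'; case: (leP s s') => [ss'|/ltW s's].
  by rewrite distrC ger0_norm ?subr_ge0// distrC; exact: H.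
by rewrite ger0_norm ?subr_ge0//; exact: H.
Qed.

(* [1 - exp (- k (s - t))] with [k = 2 / tau]: the penalty must grow at every
   time, but most of its growth must take place right after [t]. *)
Lemma steep_barrier {R : realType} (t T tau D : R) :
  t < T -> 0 < tau -> 0 < D ->
  exists h dh : R -> R, exists2 eta, 0 < eta &
    [/\ forall s : R, is_derive s 1 h (dh s), continuous dh, h t = 0,
        2 / 3 * D <= h (t + tau) &
        forall s, t <= s <= T -> 0 <= h s <= D /\ eta <= dh s].
Proof.
move=> tT tau0 D0; pose k := 2 / tau.
have k0 : 0 < k by rewrite divr_gt0.
exists (fun s => D * (1 - expR (- k * (s - t)))).
exists (fun s => D * k * expR (- k * (s - t))).
(* The derivative of the barrier decreases, so its minimum on [[t, T]] is its value at [T]. *)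
exists (D * k * expR (- k * (T - t))); first by
  apply: mulr_gt0; [exact: mulr_gt0|exact: expR_gt0].
have dlin (s : R) : is_derive s 1 (fun s => - k * (s - t)) (- k).
  have := @is_deriveZ _ _ _ (fun s => s - t) (- k) s 1 1 _.
  rewrite /GRing.scale/= mulr1; apply.
  by have := is_deriveB (is_derive_id s 1) (is_derive_cst t s 1); rewrite subr0.
have dexp (s : R) : is_derive s 1 (fun s => expR (- k * (s - t)))
    (expR (- k * (s - t)) * - k).
  exact: (@is_derive1_comp R expR (fun s => - k * (s - t)) s _ _ (is_derive_expR _) (dlin s)).
split.
- move=> s; have := @is_deriveZ _ _ _ (fun s => 1 - expR (- k * (s - t))) D s 1 _
     (is_deriveB (is_derive_cst (1 : R) s 1) (dexp s)).
  by congr (is_derive _ _ _ _); rewrite /GRing.scale/=; ring.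
- move=> s.
  have ce : {for s, continuous (fun s => expR (- k * (s - t)))}.
    apply: differentiable_continuous; apply/derivable1_diffP.
    by have [] := dexp s.
  by apply: cvgM; [exact: cvg_cst|exact: ce].
- by rewrite subrr mulr0 expR0 subrr mulr0.
- rewrite (_ : t + tau - t = tau); last by ring.
  rewrite (_ : - k * tau = - 2); last by rewrite mulNr /k divfK// gt_eqF.
  rewrite expRN.
  (* From [1 + 2 <= expR 2]; this is where [2 / 3] comes from, as [k * tau = 2]. *)
  have : (expR 2)^-1 <= 3^-1 :> R.
    rewrite lef_pV2 ?posrE ?expR_gt0//.
    by rewrite (le_trans _ (expR_ge1Dx _))//; lra.
  by move=> H; nra.
- move=> s /andP[ts sT].
  have e0 := expR_gt0 (- k * (s - t)).
  have e1 : expR (- k * (s - t)) <= 1.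
    by rewrite -expR0 ler_expR mulNr oppr_le0 mulr_ge0 ?subr_ge0// ltW.
  split; first by apply/andP; split; nra.
  have H : expR (- k * (T - t)) <= expR (- k * (s - t)).
    by rewrite ler_expR !mulNr lerN2 ler_pM2l//; lra.
  by rewrite /= ler_pM2l//; exact: mulr_gt0.
Qed.

(** * The Hamiltonian, the smoothed path and the penalized maximum *)

(** A real [sup] dominates its set only when that set is bounded above; compactness of [UU] and
    continuity in the control supply the bound. *)
Lemma hamiltonian_ge {R : realType} {n m : nat}
    (f : R -> 'rV[R]_n -> 'rV[R]_m -> 'rV[R]_n) (UU : set 'rV[R]_m) (s : R)
    (x p : 'rV[R]_n) (u : 'rV[R]_m) :
  compact UU -> {within UU, continuous (f s x)} -> UU u ->
  - dotr p (f s x u) <= hamiltonian f UU s x p.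
Proof.
move=> cU cf Uu; have [M [_ MP]] := compact_bounded (continuous_compact cf cU).
have dotE w : \sum_(i < n) (- p ord0 i) * f s x w ord0 i = - dotr p (f s x w).
  by rewrite -sumrN; apply: eq_bigr => i _; rewrite mulNr.
apply: ub_le_sup; last by exists u.
exists (n%:R * `|p| * (M + 1)) => _ [w Uw <-]; rewrite dotE.
rewrite (le_trans (ler_norm _))// normrN (le_trans (norm_dotr _ _))//.
rewrite ler_wpM2l ?mulr_ge0//; apply: (MP (M + 1)); first by rewrite ltrDl.
by exists w.
Qed.

(** The penalty is Euclidean to be smooth, while all estimates use the sup norm; this passes from
    one to the other. *)
Lemma sqr_norm_le_sqdist {R : realType} {n : nat} (x y : 'rV[R]_n) :
  `|x - y| ^+ 2 <= sqdist x y.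
Proof.
have sq0 i : 0 <= (x ord0 i - y ord0 i) ^+ 2 by exact: sqr_ge0.
have s0 : 0 <= sqdist x y by exact: sumr_ge0.
rewrite -(sqr_sqrtr s0) ler_sqr ?nnegrE ?sqrtr_ge0//.
rewrite [leLHS]/Num.Def.normr/= mx_normrE.
apply: bigmax_le => [|[i j] _ /=]; first exact: sqrtr_ge0.
rewrite (ord1 i) !mxE -sqrtr_sqr ler_sqrt// /sqdist (bigD1 j)//= lerDl.
exact: sumr_ge0.
Qed.

Lemma abs_cont_on_subitv {R : realType} {n : nat} (a b a' b' : R)
    (phi : R -> 'rV[R]_n) : a <= a' -> b' <= b ->
  abs_cont_on a b phi -> abs_cont_on a' b' phi.
Proof.
move=> aa bb acphi e /acphi[d d0 dP]; exists d => // N l r lr; apply: dP.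
move=> k /lr[al [? rb]]; split; first exact: le_trans al.
by split => //; exact: le_trans bb.
Qed.

Lemma clamp_id {R : realType} (a b s : R) : a <= s <= b -> clamp a b s = s.
Proof. by move=> /andP[as_ sb]; rewrite /clamp (min_idPr sb) (max_idPr as_). Qed.

(** Each coordinate of the clamped path is averaged separately, and [d0] is its modulus of
    continuity for [e]. The time at which an average is attained depends on the coordinate, which is
    harmless in the sup norm. *)
Lemma smoothed_path {R : realType} {n : nat} (t T e : R) (phi : R -> 'rV[R]_n) :
  t <= T -> abs_cont_on t T phi -> 0 < e ->
  exists2 d0, 0 < d0 & forall d, 0 < d < d0 ->
  exists psi dpsi : R -> 'rV[R]_n,
  [/\ forall i (s : R), 0 <= s ->
        is_derive s 1 (fun s => psi s ord0 i) (dpsi s ord0 i),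
      forall i, continuous (fun s => dpsi s ord0 i),
      forall s, dpsi s = d^-1 *: (phi (clamp t T (s + d)) - phi (clamp t T s)) &
      forall s, 0 <= s -> `|psi s - phi (clamp t T s)| < e].
Proof.
move=> tT acphi e0; have [d0 d00 d0P] := @abs_cont_on_clamp R n t T phi e tT acphi e0.
exists d0 => // d /andP[dgt0 dd0].
have cphi i : continuous (fun s => phi (clamp t T s) ord0 i).
  move=> s; apply/cvgrPdist_lt => e' e'0.
  have [r r0 rP] := @abs_cont_on_clamp R n t T phi e' tT acphi e'0.
  exists r => //= s' /rP ss'; apply: le_lt_trans ss'.
  by have := coord_le_norm (phi (clamp t T s) - phi (clamp t T s')) i; rewrite !mxE.
have /choice[psi psiP] := fun i => @steklov_average R _ d (cphi i) dgt0.
exists (fun s => \row_i psi i s).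
exists (fun s => d^-1 *: (phi (clamp t T (s + d)) - phi (clamp t T s))).
split => //.
- move=> i s s0; have [] := psiP i s s0.
  under [X in _ -> _ -> is_derive _ _ X _]eq_fun do rewrite mxE.
  by move=> + _; rewrite !mxE mulrC.
- move=> i s; rewrite /continuous_at.
  under eq_fun do rewrite !mxE; rewrite !mxE.
  apply: cvgM; first exact: cvg_cst.
  apply: cvgB; last exact: cphi.
  apply: (@cvg_comp _ _ _ (fun s => s + d) (fun s => phi (clamp t T s) ord0 i)).
    by apply: cvgD; [exact: cvg_id|exact: cvg_cst].
  exact: cphi.
- move=> s s0; apply: norm_rV_lt => // i; rewrite !mxE.
  have [_ [r /andP[sr rs] ->]] := psiP i s s0.
  apply: le_lt_trans (d0P r s _).
    by have := coord_le_norm (phi (clamp t T r) - phi (clamp t T s)) i; rewrite !mxE.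
  by rewrite ger0_norm ?subr_ge0//; lra.
Qed.

(** The maximiser is compared with [(s0, psi s0)]: at equal times [h] cancels, so the penalty is at
    most [v s0 x0 - v s0 (psi s0)]. The crude bound [2 * V] first gives distance below [r]; at that
    distance the modulus of [v] improves the bound to [rho]. *)
Lemma penalized_maximum {R : realType} {n : nat} (v : R -> 'rV[R]_n -> R)
    (psi : R -> 'rV[R]_n) (h : R -> R) (c r rho V t b B : R) :
  t <= b -> 0 < c -> 0 < r <= 1 -> 2 * V < c * r ^+ 2 ->
  let K := [set q : R * 'rV[R]_n | t <= q.1 <= b /\ `|q.2| <= B + 1] in
  {within K, continuous (fun q : R * 'rV[R]_n => v q.1 q.2)} ->
  (forall q, K q -> `|v q.1 q.2| <= V) ->
  (forall s x y, K (s, x) -> K (s, y) -> `|x - y| < r -> `|v s x - v s y| <= rho) ->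
  (forall s, t <= s <= b -> `|psi s| <= B + 1) ->
  let xi := fun s x => c * sqdist x (psi s) - h s in
  {within K, continuous (fun q : R * 'rV[R]_n => xi q.1 q.2)} ->
  exists s0 x0, [/\ K (s0, x0), `|x0 - psi s0| < r,
    c * `|x0 - psi s0| ^+ 2 <= rho &
    forall s x, K (s, x) -> v s x - xi s x <= v s0 x0 - xi s0 x0].
Proof.
move=> tb c0 /andP[r0 r1] Vc K cv VP rhoP psiB xi cxi.
have cK : compact K.
  rewrite (_ : K = `[t, b] `*` [set x : 'rV[R]_n | `|x| <= B + 1]).
    by apply: compact_setX; [exact: segment_compact|exact: compact_closed_ball0].
  by apply/seteqP; split => -[s x]/=; rewrite in_itv.
have K0 : K !=set0.
  by exists (t, psi t); split; rewrite /= ?lexx ?tb//; apply: psiB; rewrite lexx.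
have [[s0 x0] /set_mem Ksx sxP] :=
  @compact_EVT_max _ _ (fun q : R * 'rV[R]_n => v q.1 q.2 - xi q.1 q.2) K K0 cK
    (fun x => cvgB (cv x) (cxi x)).
have Kpsi : K (s0, psi s0) by case: Ksx => /= s0b _; split => //=; exact: psiB.
have sq0 : sqdist (psi s0) (psi s0) = 0.
  by rewrite /sqdist big1// => i _; rewrite subrr expr0n.
have cle : c * `|x0 - psi s0| ^+ 2 <= v s0 x0 - v s0 (psi s0).
  have := sxP _ (mem_set Kpsi); rewrite /xi/= sq0 mulr0.
  have : c * `|x0 - psi s0| ^+ 2 <= c * sqdist x0 (psi s0).
    by rewrite ler_pM2l// sqr_norm_le_sqdist.
  by move=> *; lra.
have near_ : `|x0 - psi s0| < r.
  rewrite -(@ltr_pXn2r _ 2)// ?nnegrE ?(ltW r0)//.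
  rewrite -(ltr_pM2l c0); apply: le_lt_trans Vc; apply: le_trans cle _.
  have := VP _ Ksx; have := VP _ Kpsi; rewrite /= !ler_norml => /andP[? ?] /andP[? ?].
  lra.
exists s0, x0; split => //.
  apply: le_trans cle _; apply: le_trans (ler_norm _) _; exact: rhoP.
by move=> s x Kx; have := sxP _ (mem_set Kx).
Qed.

(** * Bounds, uniform moduli and small constants *)

Lemma abs_cont_on_bounded {R : realType} {n : nat} (t T : R) (phi : R -> 'rV[R]_n) :
  t <= T -> abs_cont_on t T phi ->
  exists2 B, 0 <= B & forall s, `|phi (clamp t T s)| <= B.
Proof.
move=> tT acphi.
have cphi : continuous (fun s => phi (clamp t T s)).
  move=> s; apply/cvgrPdist_lt => e e0.
  have [r r0 rP] := @abs_cont_on_clamp R n t T phi e tT acphi e0.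
  by exists r => //= s' /rP.
have [M [_ MP]] := compact_bounded
  (continuous_compact (continuous_subspaceT cphi) (segment_compact (a := t) (b := T))).
have H s : `|phi (clamp t T s)| <= M + 1.
  apply: (MP (M + 1)); first by rewrite ltrDl.
  have cs : t <= clamp t T s <= T.
    rewrite /clamp /Num.max /Num.min.
    by repeat case: ifPn; rewrite -?leNgt; lra.
  by exists (clamp t T s); [rewrite /= in_itv|rewrite clamp_id].
by exists (M + 1); [apply: le_trans (H t)|].
Qed.

Lemma ball_rV_lt {R : realType} {n : nat} (x y : 'rV[R]_n) (e : R) : ball x e y = (`|x - y| < e) :> Prop.
Proof. by rewrite -ball_normE. Qed.

Lemma unif_continuous_slab {R : realType} {n : nat} (F : R -> 'rV[R]_n -> R)
    (a b B e : R) : 0 < e ->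
  {within [set q : R * 'rV[R]_n | a <= q.1 <= b],
    continuous (fun q : R * 'rV[R]_n => F q.1 q.2)} ->
  exists2 r, 0 < r <= 1 & forall s s' x x', a <= s <= b -> a <= s' <= b ->
    `|x| <= B -> `|x'| <= B -> `|s - s'| < r -> `|x - x'| < r ->
    `|F s x - F s' x'| < e.
Proof.
move=> e0 cF.
have cK : compact (`[a, b] `*` [set x : 'rV[R]_n | `|x| <= B]).
  by apply: compact_setX; [exact: segment_compact|exact: compact_closed_ball0].
have cFK : {within `[a, b] `*` [set x : 'rV[R]_n | `|x| <= B],
    continuous (fun q : R * 'rV[R]_n => F q.1 q.2 : R^o)}.
  by apply: continuous_subspaceW cF => -[s x]/= []; rewrite in_itv.
have [r r0 rP] := @compact_within_unif_continuous _ _ _ _ _ _ cK cFK e0.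
exists (Num.min r 1); first by rewrite lt_min r0 ltr01 ge_min lexx orbT.
move=> s s' x x' sab s'ab xB x'B; rewrite !lt_min => /andP[ss _] /andP[xx _].
apply: (rP (s, x) (s', x')); [by rewrite /= in_itv|by rewrite /= in_itv|].
by split => //=; rewrite ball_rV_lt.
Qed.

Lemma unif_continuous_dynamics {R : realType} {n m : nat}
    (f : R -> 'rV[R]_n -> 'rV[R]_m -> 'rV[R]_n) (UU : set 'rV[R]_m) (T B e : R) :
  0 < e -> compact UU ->
  {within [set p : R * 'rV[R]_n * 'rV[R]_m | Icc 0 T p.1.1 /\ UU p.2],
     continuous (fun p : R * 'rV[R]_n * 'rV[R]_m => f p.1.1 p.1.2 p.2)} ->
  exists2 r, 0 < r & forall s s' x x' u, Icc 0 T s -> Icc 0 T s' -> UU u ->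
    `|x| <= B -> `|x'| <= B -> `|s - s'| < r -> `|x - x'| < r ->
    `|f s x u - f s' x' u| < e.
Proof.
move=> e0 cU cf; pose K := `[0, T] `*` [set x : 'rV[R]_n | `|x| <= B] `*` UU.
have cK : compact K.
  apply: compact_setX => //.
  by apply: compact_setX; [exact: segment_compact|exact: compact_closed_ball0].
have cfK : {within K, continuous (fun p : R * 'rV[R]_n * 'rV[R]_m => f p.1.1 p.1.2 p.2)}.
  by apply: continuous_subspaceW cf => -[[s x] u]/= [[]]/=; rewrite in_itv.
have [r r0 rP] := @compact_within_unif_continuous _ _ _ _ _ _ cK cfK e0.
exists r => // s s' x x' u sT s'T Uu xB x'B ss xx.
apply: (rP (s, x, u) (s', x', u)); rewrite /K/= ?in_itv//.
by split; [split => //=; rewrite ball_rV_lt|exact: ballxx].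
Qed.

(** Pattern for the choice of tolerances: an error with coefficient at most [b] costs a quarter of
    [e], and the added 1 permits [b = 0]. *)
Lemma mulr_divD1_le {R : realType} (a b e : R) : 0 <= a -> a <= b -> 0 <= e ->
  a * (e / (4 * (b + 1))) <= e / 4.
Proof.
move=> a0 ab e0; have b1 : 0 < b + 1 by lra.
have -> : a * (e / (4 * (b + 1))) = (a / (b + 1)) * (e / 4).
  by field; rewrite gt_eqF.
have H : a / (b + 1) <= 1 by rewrite ler_pdivrMr//; lra.
by rewrite ler_piMl// divr_ge0.
Qed.

Lemma continuous_pairl {X Y : topologicalType} (x : X) :
  continuous (fun y : Y => (x, y)).
Proof.
move=> y W [[A B]/= [/nbhs_singleton Ax By] ABW].
by apply: filterS By => z Bz; apply: ABW.
Qed.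

Lemma exists_pos_lt_all {R : realType} (s : seq R) :
  all (> 0) s -> exists2 d, 0 < d & all (> d) s.
Proof.
elim: s => [_|e s IHs /= /andP[e0 /IHs[d d0 sd]]]; first by exists 1.
exists (Num.min (e / 2) d); first by rewrite lt_min d0 divr_gt0.
apply/andP; split.
  by rewrite gt_min ltr_pdivrMr// ltr_pMr// ltr1n.
by apply: sub_all sd => y dy; rewrite gt_min dy orbT.
Qed.

(** * Growth of a trajectory in a fixed direction *)

(** At almost every [s] the hypothesis on [w] is used with [w = u s]. Moving from [f s0 x0] to the
    actual velocity costs at most [3 / 4 * eta], which leaves the slope [q + eta / 4]; the mean
    value inequality is applied with the smaller [q + eta / 8] to have strictness on both sides. *)
Lemma trajectory_increment_gt {R : realType} {n m : nat}
    (f : R -> 'rV[R]_n -> 'rV[R]_m -> 'rV[R]_n) (UU : set 'rV[R]_m)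
    (phi : R -> 'rV[R]_n) (u : R -> 'rV[R]_m) (p x0 : 'rV[R]_n)
    (s0 d q eta e1 e2 : R) :
  0 < d -> 0 < eta -> abs_cont_on s0 (s0 + d) phi ->
  {ae lebesgue_measure, forall s : R, s0 < s < s0 + d ->
     derivable phi s 1 /\ 'D_1 phi s = f s (phi s) (u s)} ->
  (forall s, s0 < s < s0 + d -> UU (u s)) ->
  (forall s, s0 < s < s0 + d ->
     `|f s (phi s) (u s) - f s0 (phi s0) (u s)| <= e1) ->
  (forall w, UU w -> `|f s0 (phi s0) w - f s0 x0 w| <= e2) ->
  n%:R * `|p| * (e1 + e2) <= 3 / 4 * eta ->
  (forall w, UU w -> q + eta <= dotr p (f s0 x0 w)) ->
  q * d < dotr p (phi (s0 + d)) - dotr p (phi s0).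
Proof.
move=> d0 eta0 acphi dphi uU e1P e2P pe qP.
apply: (@lt_le_trans _ _ ((q + eta / 8) * (s0 + d - s0))).
  by rewrite addrAC subrr add0r ltr_pM2r// ltrDl divr_gt0.
apply: abs_cont_on_increment_ge => //; first by rewrite lerDl ltW.
case: dphi => N [mN N0 NP]; exists N; split => //; apply: subset_trans NP.
apply: subsetC => s /= + sd => /(_ sd)[dphi Ds]; split => //; rewrite Ds.
have Uu := uU _ sd.
have : `|f s (phi s) (u s) - f s0 x0 (u s)| <= e1 + e2.
  rewrite (_ : _ - _ = (f s (phi s) (u s) - f s0 (phi s0) (u s)) +
    (f s0 (phi s0) (u s) - f s0 x0 (u s))); last by rewrite addrA subrK.
  by rewrite (le_trans (ler_normD _ _))// lerD ?e1P ?e2P.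
move=> /(ler_wpM2l (mulr_ge0 (ler0n R n) (normr_ge0 p))).
have := norm_dotr p (f s (phi s) (u s) - f s0 x0 (u s)).
rewrite dotrB ler_norml => /andP[+ _].
move: (qP _ Uu) => *; lra.
Qed.

(** * The contradiction at a penalized maximum *)

Theorem theorem4 (R : realType) (n m : nat) (T : R)
    (UU : set 'rV[R]_m) (f : R -> 'rV[R]_n -> 'rV[R]_m -> 'rV[R]_n)
    (g : 'rV[R]_n -> R) (v : R -> 'rV[R]_n -> R) (gl : 'rV[R]_n -> R) :
  0 < T ->
  compact UU -> UU !=set0 ->
  {within [set p : R * 'rV[R]_n * 'rV[R]_m | Icc 0 T p.1.1 /\ UU p.2],
     continuous (fun p : R * 'rV[R]_n * 'rV[R]_m => f p.1.1 p.1.2 p.2)} ->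
  (exists L : R, forall s (x y : 'rV[R]_n) u, Icc 0 T s -> UU u ->
     `|f s x u - f s y u| <= L * `|x - y|) ->
  continuous g ->
  {within [set p : R * 'rV[R]_n | Icc 0 T p.1],
     continuous (fun p : R * 'rV[R]_n => v p.1 p.2)} ->
  visc_subsolution f UU [set p : R * 'rV[R]_n | 0 < p.1 < T /\ 0 < v p.1 p.2] v ->
  (forall x, v T x = gl x) ->
  (forall x, g x <= 0 -> gl x <= 0) ->
  forall t, Icc 0 T t ->
    reach_set f UU g T t `<=` [set x | v t x <= 0].
Proof.
move=> T0 cU U0 cf [L LP] _ cv sub vT gl0 t /andP[t0 tT] x.
move=> [u [_ uU] [phi [[acphi phit dphi] gphi]]] /=.
rewrite leNgt; apply/negP; set A := v t x => A0.
have vTphi : v T (phi T) <= 0 by rewrite vT gl0.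
have {}tT : t < T.
  rewrite lt_neqAle tT andbT; apply/eqP => tT'.
  by move: vTphi; rewrite -tT' phit leNgt A0.
have tT' := ltW tT.
have [B B0 BP] := @abs_cont_on_bounded R n t T phi tT' acphi.
pose pc s := phi (clamp t T s).
have pcE s : t <= s <= T -> pc s = phi s by move=> ?; rewrite /pc clamp_id.
have mod_pc := fun e => @abs_cont_on_clamp R n t T phi e tT' acphi.
have cv' : {within [set q : R * 'rV[R]_n | t <= q.1 <= T],
    continuous (fun q : R * 'rV[R]_n => v q.1 q.2)}.
  apply: continuous_subspaceW cv => -[s y]/= /andP[ts sT].
  by rewrite /Icc/= (le_trans t0).
have mod_v := fun e e0 => @unif_continuous_slab R n v t T (B + 1) e e0 cv'.
have [V VP] : exists V, forall s y, t <= s <= T -> `|y| <= B + 1 -> `|v s y| <= V.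
  have cK : compact (`[t, T] `*` [set y : 'rV[R]_n | `|y| <= B + 1]).
    by apply: compact_setX; [exact: segment_compact|exact: compact_closed_ball0].
  have cvK : {within `[t, T] `*` [set y : 'rV[R]_n | `|y| <= B + 1],
      continuous (fun q : R * 'rV[R]_n => v q.1 q.2 : R^o)}.
    by apply: continuous_subspaceW cv' => -[s y]/= []; rewrite in_itv.
  have [M [_ MP]] := compact_bounded (continuous_compact cvK cK).
  exists (M + 1) => s y st yB; apply: (MP (M + 1)); first by rewrite ltrDl.
  by exists (s, y) => //; split => //=; rewrite in_itv.
have pcB s : `|pc s| <= B + 1 by rewrite (le_trans (BP s))// lerDl.
have V0 : 0 <= V by apply: le_trans (VP t x _ _) => //; rewrite ?lexx//= -phit -pcE ?lexx.
have T2 : 0 < (T - t) / 2 by rewrite divr_gt0 ?subr_gt0.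
have [rA /andP[rA0 _] rAP] := mod_v _ (divr_gt0 A0 (ltr0n R 8)).
have [rA' rA'0 rA'P] := mod_pc _ rA0.
(* On [[t, t + tau]] the value along the path drops by less than [A / 8]. Both [tau] and the later
   step [d] stay below [(T - t) / 2], so that [t + tau <= T - d]. *)
have [tau [tau0 taur taur' tauT]] :
    exists tau, [/\ 0 < tau, tau < rA, tau < rA' & tau < (T - t) / 2].
  have [|tau tau0 /and4P[? ? ? _]] := @exists_pos_lt_all R [:: rA; rA'; (T - t) / 2].
    by rewrite /= rA0 rA'0 T2.
  by exists tau.
have ttau : t <= t + tau <= T by clear -tau0 tauT tT; apply/andP; split; lra.
have vtau : 7 / 8 * A <= v (t + tau) (pc (t + tau)).
  have : `|v t (pc t) - v (t + tau) (pc (t + tau))| < A / 8.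
    apply: rAP => //; first by rewrite lexx.
      by rewrite opprD addrA subrr add0r normrN gtr0_norm.
    by apply: rA'P; rewrite opprD addrA subrr add0r normrN gtr0_norm.
  rewrite (pcE t) ?lexx// phit -/A ltr_norml => /andP[_].
  by clear; lra.
(* With height [3 / 4 * A] the barrier reaches [A / 2] at [t + tau], so the maximum is about
   [11 / 8 * A]. This exceeds [A], the value at the start, and [3 / 4 * A], the most that is
   possible where [v] is nonpositive. *)
have D0 : 0 < 3 / 4 * A by rewrite mulr_gt0// divr_gt0.
have [h [dh [eta eta0 [hder dhc ht htau hP]]]] := @steep_barrier R t T tau _ tT tau0 D0.
pose L' := `|L|; have L'0 : 0 <= L' by exact: normr_ge0.
have LP' s (y z : 'rV[R]_n) w : Icc 0 T s -> UU w ->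
    `|f s y w - f s z w| <= L' * `|y - z|.
  move=> sT Uw; apply: le_trans (LP s y z w sT Uw) _.
  by rewrite ler_wpM2r// ler_norm.
pose n' : R := n%:R; have n'0 : 0 <= n' by exact: ler0n.
(* The first bound keeps the margins in multiples of [A]; the second makes the doubling error
   [n' * L' * 2 * rho] at most [eta / 4]. *)
pose rho := Num.min (A / 32) (eta / (4 * (n' * L' * 2 + 1))).
have nL0 : 0 <= n' * L' by exact: mulr_ge0.
have rho0 : 0 < rho.
  rewrite lt_min; apply/andP; split; apply: divr_gt0 => //.
  by clear -nL0; lra.
have rhoA : rho <= A / 32 by rewrite ge_min lexx.
have rhoe : n' * L' * 2 * rho <= eta / 4.
  apply: (@le_trans _ _ (n' * L' * 2 * (eta / (4 * (n' * L' * 2 + 1))))).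
    by rewrite ler_wpM2l ?mulr_ge0// ge_min lexx orbT.
  by apply: mulr_divD1_le; rewrite ?(ltW eta0)//; exact: mulr_ge0.
have [r /andP[r0 r1] rP] := mod_v _ rho0.
pose c := (2 * V + 1) / (r / 2) ^+ 2.
have r20 : 0 < (r / 2) ^+ 2 by rewrite exprn_gt0// divr_gt0.
have c0 : 0 < c by apply: divr_gt0 => //; rewrite ltr_wpDl// mulr_ge0.
have cV : 2 * V < c * (r / 2) ^+ 2 by rewrite divfK ?gt_eqF// ltrDl.
(* [P] will bound [n * |p|] and depends on [c] only, so the tolerances [e1] and [e2] and then the
   step [d] can be chosen after [c]. *)
pose P := n' * (c * 2); have P0 : 0 <= P by rewrite mulr_ge0// mulr_ge0// ltW.
pose e1 := eta / (4 * (P + 1)).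
have e10 : 0 < e1 by apply: divr_gt0 => //; rewrite mulr_gt0// ltr_wpDl.
pose e2 := Num.min (r / 4) (eta / (4 * (P * L' + 1))).
have PL0 : 0 <= P * L' by exact: mulr_ge0.
have e20 : 0 < e2.
  rewrite lt_min; apply/andP; split; apply: divr_gt0 => //.
  by rewrite mulr_gt0// ltr_wpDl.
have e2r : e2 <= r / 4 by rewrite ge_min lexx.
have [rf rf0 rfP] := @unif_continuous_dynamics R n m f UU T (B + 1) e1 e10 cU cf.
have [df df0 dfP] := mod_pc _ rf0.
have r40 : 0 < r / 4 by rewrite divr_gt0.
have [dr dr0 drP] := mod_pc _ r40.
have [d0 d00 d0P] := @smoothed_path R n t T e2 phi tT' acphi e20.
have [d [dgt0 dd0 [ddf ddr] drf [dr' dT]]] : exists d, [/\ 0 < d, d < d0,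
    d < df /\ d < dr, d < rf & d < r /\ d < (T - t) / 2].
  have [|d ? /= /and5P[? ? ? ? /and3P[? ? _]]] :=
      @exists_pos_lt_all R [:: d0; df; dr; rf; r; (T - t) / 2].
    by rewrite /= d00 df0 dr0 rf0 r0 T2.
  by exists d.
have [|psi [dpsi [psiD dpsic dpsiE psiP]]] := d0P d; first by rewrite dgt0 dd0.
(* Stopping at [T - d] keeps [[s0, s0 + d]] inside the time interval of the trajectory. *)
pose b := T - d.
have tb : t <= b by clear -dT tT b; rewrite /b; lra.
have bT : b < T by rewrite /b ltrBlDr ltrDl.
have r21 : 0 < r / 2 <= 1 by clear -r0 r1; apply/andP; split; lra.
have r2r : r / 2 < r by clear -r0; lra.
have r4r : r / 4 < r by clear -r0; lra.
have r41 : r / 4 <= 1 by clear -r0 r1; lra.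
have r24 : r / 2 + r / 4 < r by clear -r0; lra.
have r241 : r / 2 + r / 4 < 1 by clear -r0 r1; lra.
pose Omega := [set p : R * 'rV[R]_n | 0 < p.1 < T /\ 0 < v p.1 p.2].
have Omega0 p : Omega p -> 0 < p.1 by case=> /andP[].
have [xidt xigrad xiC1 xic] :=
  @tracking_test_function R n c psi dpsi h dh Omega psiD dpsic hder dhc Omega0.
pose xi := fun s y => c * sqdist y (psi s) - h s.
have psiB s : t <= s -> `|psi s| <= B + r / 4.
  move=> ts; rewrite -(subrK (pc s) (psi s)) (le_trans (ler_normD _ _))//.
  rewrite [leRHS]addrC lerD//; last exact: BP.
  by apply: le_trans e2r; apply/ltW/psiP; exact: le_trans ts.
have [s0 [x0 [[/=/andP[ts0 s0b] x0B] x0r x0rho maxP]]] : exists s0 x0,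
    [/\ [set q : R * 'rV[R]_n | t <= q.1 <= b /\ `|q.2| <= B + 1] (s0, x0),
    `|x0 - psi s0| < r / 2, c * `|x0 - psi s0| ^+ 2 <= rho &
    forall s y, [set q : R * 'rV[R]_n | t <= q.1 <= b /\ `|q.2| <= B + 1] (s, y) ->
      v s y - xi s y <= v s0 x0 - xi s0 x0].
  apply: (@penalized_maximum R n v psi h c (r / 2) rho V t b B) => //.
  - apply: continuous_subspaceW cv' => -[s y]/= [/andP[-> /=]] sb _.
    by rewrite (le_trans sb)// ltW.
  - move=> [s y]/= [/andP[ts sb] yB]; apply: VP => //.
    by rewrite ts/= (le_trans sb)// ltW.
  - move=> s y z [/=/andP[ts sb] yB] [/= _ zB] yz; apply/ltW/rP => //.
    + by rewrite ts/= (le_trans sb)// ltW.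
    + by rewrite ts/= (le_trans sb)// ltW.
    + by rewrite subrr normr0.
    + exact: lt_trans r2r.
  - by move=> s /andP[ts _]; rewrite (le_trans (psiB s ts))// lerD2l.
  - apply: continuous_in_subspaceT => -[s y] /set_mem[/=/andP[ts _] _].
    by apply: xic; rewrite /= (le_trans t0).
have sqdist0 (y : 'rV[R]_n) : sqdist y y = 0.
  by rewrite /sqdist big1// => i _; rewrite subrr expr0n.
have sqdist_ge0 (y z : 'rV[R]_n) : 0 <= sqdist y z.
  by apply: sumr_ge0 => i _; exact: sqr_ge0.
have x0pc : `|x0 - pc s0| < r / 2 + r / 4.
  rewrite -(subrK (psi s0) x0) -addrA (le_lt_trans (ler_normD _ _))// ltrD//.
  by rewrite (lt_le_trans _ e2r)// psiP// (le_trans t0).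
have s0T : t <= s0 <= T by rewrite ts0/= (le_trans s0b)// ltW.
(* The competitor is [(t + tau, psi (t + tau))], where the penalty vanishes; [rho] pays for
   replacing the path by its average. *)
have gap : 11 / 8 * A - rho <= v s0 x0 - xi s0 x0.
  have ttaub : t <= t + tau <= b.
    by clear -tau0 tauT dT; rewrite /b; apply/andP; split; lra.
  have psitau : `|psi (t + tau)| <= B + 1 by rewrite (le_trans (psiB _ _)) ?lerD2l//; case/andP: ttau.
  have := maxP (t + tau) (psi (t + tau)) (conj ttaub psitau).
  rewrite [X in _ - X <= _]/xi sqdist0 mulr0 sub0r opprK.
  have : `|v (t + tau) (psi (t + tau)) - v (t + tau) (pc (t + tau))| < rho.
    apply: rP => //; first by rewrite subrr normr0.
    apply: lt_trans r4r; apply: lt_le_trans e2r; apply: psiP.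
    by apply: le_trans t0 _; case/andP: ttau.
  rewrite ltr_norml => /andP[+ _]; move: htau vtau; clear; lra.
have xi_ge : v s0 x0 - xi s0 x0 <= v s0 x0 + h s0.
  have := mulr_ge0 (ltW c0) (sqdist_ge0 x0 (psi s0)).
  by rewrite /xi; clear; lra.
have [hs0 etas0] := hP s0 s0T.
have {}hs0 : h s0 <= 3 / 4 * A by case/andP: hs0.
have vpos : 0 < v s0 x0 by move: gap xi_ge rhoA hs0 A0; clear; lra.
(* At [s0 = t] the barrier is zero and [v s0 x0] is within [rho] of [A], below the gap. *)
have ts0' : t < s0.
  rewrite lt_neqAle ts0 andbT; apply/eqP => s0t.
  have : `|v s0 x0 - v s0 (pc s0)| < rho.
    by apply: rP => //; [rewrite subrr normr0|exact: lt_trans r24].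
  rewrite pcE// ltr_norml -s0t phit -/A => /andP[_].
  by move: gap xi_ge; rewrite -s0t ht; move: rhoA A0; clear; lra.
(* At [s0 = T - d] the point is close enough to [(T, phi T)] to make [v s0 x0 < rho], and the
   barrier adds at most [3 / 4 * A]. *)
have s0b' : s0 < b.
  rewrite lt_neqAle s0b andbT; apply/eqP => s0b'.
  have dist : `|s0 - T| = d.
    by rewrite s0b' /b addrAC subrr add0r normrN gtr0_norm.
  have : `|v s0 x0 - v T (pc T)| < rho.
    apply: rP => //; [by rewrite lexx andbT|by rewrite dist|].
    have := drP s0 T; rewrite dist => /(_ ddr) dpc.
    rewrite -(subrK (pc s0) x0) -addrA (le_lt_trans (ler_normD _ _))//.
    by move: dpc x0pc; rewrite -/(pc s0) -/(pc T); clear -r0; lra.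
  rewrite ltr_norml pcE ?lexx ?tT'// => /andP[_].
  by move: gap xi_ge vTphi rhoA hs0 A0; clear; lra.
have x0B' : `|x0| < B + 1.
  rewrite -(subrK (pc s0) x0) (le_lt_trans (ler_normD _ _))// addrC.
  by have := BP s0; rewrite -/(pc s0); move: x0pc r241; clear; lra.
have Os0 : Omega (s0, x0) by split => //=; rewrite (le_lt_trans t0 ts0') (lt_trans s0b' bT).
have nearP : \forall q \near (s0, x0),
    v q.1 q.2 - xi q.1 q.2 <= v s0 x0 - xi s0 x0.
  have c1 : (fst : R * 'rV[R]_n -> R) q @[q --> (s0, x0)] --> s0 by exact: cvg_fst.
  have c2 : (snd : R * 'rV[R]_n -> 'rV[R]_n) q @[q --> (s0, x0)] --> x0.
    exact: cvg_snd.
  have n1 : \forall q \near (s0, x0), t < q.1 by exact: cvgr_gt c1 _ ts0'.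
  have n2 : \forall q \near (s0, x0), q.1 < b by exact: cvgr_lt c1 _ s0b'.
  have n3 : \forall q \near (s0, x0), `|q.2| < B + 1.
    exact: cvgr_norm_lt c2 _ x0B'.
  near=> q; apply: maxP; split => /=; last by apply/ltW; near: q.
  by apply/andP; split; apply/ltW; near: q.
have s00 : 0 <= s0 by rewrite (le_trans t0).
have IccT s : t <= s <= T -> Icc 0 T s.
  by move=> /andP[ts sT]; rewrite /Icc/= (le_trans t0).
have := sub xi xiC1 s0 x0 Os0 nearP.
rewrite xidt// xigrad; set p := (c * 2) *: (x0 - psi s0) => Hle.
(* The subsolution inequality, with the Hamiltonian bounded below by one control value and [dh s0]
   by [eta]. *)
have pf w : UU w -> dotr p (dpsi s0) + eta <= dotr p (f s0 x0 w).
  move=> Uw.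
  have cfs : {within UU, continuous (f s0 x0)}.
    have UUP (y : 'rV[R]_m) : UU y -> [set q : R * 'rV[R]_n * 'rV[R]_m |
        Icc 0 T q.1.1 /\ UU q.2] (s0, x0, y).
      by move=> Uy; split => //=; exact: IccT.
    exact: within_continuous_precomp UU _ _ _ (continuous_pairl (s0, x0)) UUP cf.
  have := hamiltonian_ge f UU s0 x0 p w cU cfs Uw; move: Hle etas0; clear; lra.
have c20 : 0 <= c * 2 by rewrite mulr_ge0// ltW.
have pn : n%:R * `|p| <= P.
  have x01 : `|x0 - psi s0| <= 1.
    by apply/ltW/(lt_le_trans x0r); case/andP: r21.
  rewrite /P -/n' ler_wpM2l// normrZ (ger0_norm c20).
  by rewrite ler_piMr.
have np0 : 0 <= n%:R * `|p| by rewrite mulr_ge0.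
have s0dT : t <= s0 + d <= T.
  by clear -ts0 s0b dgt0; rewrite /b in s0b; apply/andP; split; lra.
(* Since [dpsi s0] is the difference quotient of [phi] over [[s0, s0 + d]], both sides are equal and
   the strict inequality is absurd. *)
suff : dotr p (dpsi s0) * d < dotr p (phi (s0 + d)) - dotr p (phi s0).
  rewrite dpsiE (clamp_id t T _ s0dT) (clamp_id t T _ s0T).
  rewrite -dotrB => H; move: H; rewrite (_ : dotr p (_ *: _) * d = dotr p (phi (s0 + d) - phi s0)) ?ltxx//.
  rewrite /dotr mulr_suml; apply: eq_bigr => i _; rewrite !mxE.
  by field; rewrite gt_eqF.
have sd s : s0 < s < s0 + d -> t <= s <= T.
  move=> /andP[s0s sd]; rewrite (le_trans ts0 (ltW s0s))/=.
  by case/andP: s0dT => _; exact/le_trans/ltW.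
apply: (@trajectory_increment_gt R n m f UU phi u p x0 s0 d _ eta e1
  (L' * (e2 + `|x0 - psi s0|))) => //.
- by apply: abs_cont_on_subitv acphi => //; case/andP: s0dT.
- case: dphi => N [mN N0 NP]; exists N; split => //; apply: subset_trans NP.
  apply: subsetC => s /= H ss; apply: H.
  case/andP: ss s0dT => s0s ssd /andP[_ sdT].
  by rewrite (lt_trans ts0' s0s) (lt_le_trans ssd sdT).
- by move=> s /sd st; apply: uU; rewrite /Icc/=.
- move=> s ss; have ssd : `|s - s0| < d.
    by clear -ss; case/andP: ss => ? ?; rewrite gtr0_norm; lra.
  have st := sd s ss; apply/ltW/rfP.
  + exact: IccT.
  + exact: IccT.
  + exact: uU.
  + by rewrite -pcE.
  + by rewrite -pcE.
  + exact: lt_trans drf.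
  + by rewrite -!pcE//; apply: dfP; exact: lt_trans ddf.
- move=> w Uw; apply: le_trans (LP' _ _ _ _ (IccT _ s0T) Uw) _.
  rewrite ler_wpM2l// -(subrK (psi s0) (phi s0)) -addrA.
  rewrite (le_trans (ler_normD _ _))// lerD//; last by rewrite distrC.
  by rewrite distrC -pcE// ltW// psiP.
- have h1 : n%:R * `|p| * e1 <= eta / 4 by apply: mulr_divD1_le => //; exact: ltW.
  have h2 : n%:R * `|p| * L' * e2 <= eta / 4.
    apply: (@le_trans _ _ (n%:R * `|p| * L' * (eta / (4 * (P * L' + 1))))).
      by rewrite ler_wpM2l ?mulr_ge0// ge_min lexx orbT.
    apply: mulr_divD1_le; [exact: mulr_ge0|exact: ler_wpM2r|exact: ltW].
  (* The factor [c] may be huge, but [|p|] is [2 * c * |x0 - psi s0|], so the product contains the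
     penalty [c * |x0 - psi s0| ^+ 2], which is at most [rho]. *)
  have h3 : n%:R * `|p| * L' * `|x0 - psi s0| <= eta / 4.
    apply: le_trans rhoe.
    rewrite normrZ (ger0_norm c20).
    set y := `|x0 - psi s0|.
    have -> : n%:R * (c * 2 * y) * L' * y = n' * L' * 2 * (c * y ^+ 2).
      by rewrite /n'; clear; ring.
    by rewrite ler_wpM2l ?mulr_ge0.
  by move: h1 h2 h3; rewrite !mulrDr !mulrA; clear; lra.
Unshelve. all: by end_near. Qed.
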